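(* Let $A$, $A'$ and $M$ be integers with $0<A,A'\le M$, let $r$ be a positive integer and let $s$ be a positive integer. Then $$\lim_{n\to\infty}\frac{\varsigma_{M,A}^{[s]}(r;n)}{\varsigma_{M,A'}^{[s]}(r;n)}=1.$$
   Context: A partition $\pi$ of $n$ (written $\pi\vdash n$) is a weakly decreasing finite sequence of positive integers, called parts, with sum $n$. The frequency of a positive integer $k$ in $\pi$ is the number of times $k$ occurs as a part of $\pi$ (possibly $0$). For a positive integer $s$ and integers $A,M$ with $0<A\le M$, $\operatorname{mex}_{M,A}^{[s]}(\pi)$ denotes the smallest positive integer congruent to $A$ modulo $M$ whose frequency in $\pi$ is less than $s$. For a nonnegative integer $r$, define $$\varsigma_{M,A}^{[s]}(r;n):=\sum_{\pi\vdash n}\big(\operatorname{mex}_{M,A}^{[s]}(\pi)\big)^r.$$ *)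

(* Defs.v *)
From mathcomp Require Import all_boot all_order all_algebra.
From mathcomp Require Import all_classical all_reals all_analysis.

Set Implicit Arguments.
Unset Strict Implicit.
Unset Printing Implicit Defensive.

Definition is_partition (n : nat) (p : seq nat) : bool :=
  [&& sorted geq p, all (fun k => 0 < k) p & sumn p == n].

(* The partitions of n form a finite type only after bounding them: a partition
   of n has at most n parts, each at most n.  Lemmas partition_bseq and
   bseq_parts_inj show that the sum over the codes b : n.-bseq 'I_n.+1 meets
   every partition of n exactly once. *)
Definition parts (n : nat) (b : n.-bseq 'I_n.+1) : seq nat :=
  [seq nat_of_ord i | i <- b].

Definition mex_cand (M A s : nat) (p : seq nat) : pred nat :=
  fun k => [&& 0 < k, k == A %[mod M] & count_mem k p < s].

(* The value 0 is a dummy for s = 0, see mexP. *)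
Definition mex (M A s : nat) (p : seq nat) : nat :=
  match pselect (exists k, mex_cand M A s p k) with
  | left ex_k => ex_minn ex_k
  | right _ => 0
  end.

Definition mex_sum (M A s r n : nat) : nat :=
  \sum_(b : n.-bseq 'I_n.+1 | is_partition n (parts b)) mex M A s (parts b) ^ r.

Lemma bseq_parts_inj n : injective (@parts n).
Proof. by move=> b c bc; apply/val_inj/(inj_map val_inj). Qed.

Lemma mem_leq_sumn (p : seq nat) k : k \in p -> k <= sumn p.
Proof.
elim: p => //= j p IHp; rewrite inE; case/predU1P=> [->|/IHp le_kp].
  exact: leq_addr.
exact: leq_trans le_kp (leq_addl _ _).
Qed.

Lemma partition_bseq n p :
  is_partition n p -> exists b : n.-bseq 'I_n.+1, parts b = p.
Proof.
case/and3P=> _ p_gt0 /eqP sum_p.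
have le_n k : k \in p -> k <= n by rewrite -sum_p; exact: mem_leq_sumn.
have szp : size [seq inord k : 'I_n.+1 | k <- p] <= n.
  rewrite size_map -sum_p; elim: p p_gt0 {sum_p le_n} => //= j p IHp.
  by case/andP=> j_gt0 /IHp; rewrite -add1n; apply: leq_add.
exists (Bseq szp); rewrite /parts /= -map_comp -[RHS]map_id.
by apply/eq_in_map => k /le_n le_kn /=; rewrite inordK.
Qed.

Lemma mexP M A s p : 0 < A <= M -> 0 < s ->
  mex_cand M A s p (mex M A s p)
  /\ forall k, mex_cand M A s p k -> mex M A s p <= k.
Proof.
case/andP=> A_gt0 le_AM s_gt0; rewrite /mex; case: pselect => [ex_k | []].
  by case: ex_minnP.
exists ((sumn p).+1 * M + A); apply/and3P; split.
- by rewrite addn_gt0 A_gt0 orbT.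
- by rewrite modnMDl.
suff /count_memPn -> : (sumn p).+1 * M + A \notin p by [].
have M_gt0 := leq_trans A_gt0 le_AM.
apply/negP => /mem_leq_sumn; rewrite leqNgt => /negP; apply.
by rewrite (leq_trans _ (leq_addr _ _)) // leq_pmulr.
Qed.

(* Main.v *)
Require Import Defs.
From mathcomp Require Import all_boot all_order all_algebra.
From mathcomp Require Import all_classical all_reals all_analysis.
From mathcomp Require Import zify lra.
Import Order.TTheory GRing.Theory Num.Theory numFieldNormedType.Exports.

(** Let p(n) be the number of partitions of n, and draw a partition of n
uniformly at random, so that the two sums become the expectations of the r-th
powers of the mexes X and X' attached to A and A'.

The mex attached to A is at least A + j M exactly when the partition contains s
copies of each of A, A + M, ..., A + (j - 1) M.  Removing these parts shows that
there are p(n - c) such partitions of n, with c <= n the total weight removed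
([count_contains], [contains_run_mex]).  The weight for A and j is at most the
weight for A' and j + 1, and p is nondecreasing; hence the tail of X' lies below
the tail of X + 3 M ([mex_tail_le]), and the same holds with A and A' exchanged.
By summation by layers ([leq_sum_tails]),
  E X'^r <= E (X + 3 M)^r <= (1 + 1/L) E X^r + C / L
for every L, with C depending only on L, M and r ([expn_shift_le]).

The constant is harmless as soon as E X^r tends to infinity
([mex_sum_superlinear]).  This follows from p(n - c) >= p(n) / 2 for fixed c and
large n ([num_partitions_shift]): then each event X >= A + j M has probability
at least 1/2 when n is large.

That inequality is a consequence of p(n) - p(n - 1) = o(p(n)), where the
difference counts the partitions of n without a part 1 ([no_ones_small]).  In
such a partition, replacing one part k by k ones gives a partition of n from
which k, hence the original partition, can be read off; so the total number of
distinct part sizes, summed over the partitions without ones, is at most p(n)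
([sum_distinct_parts_le]).  Partitions with at most L distinct sizes are
polynomially many in n ([count_few_sizes]), whereas p(n) outgrows every
polynomial ([num_partitions_ge]); all other partitions without ones contribute
more than L to that total. *)

Set Implicit Arguments.
Unset Strict Implicit.
Unset Printing Implicit Defensive.

(** * Partitions as a duplicate-free list *)

Definition partitions (n : nat) : seq (seq nat) :=
  [seq parts b | b <- enum [pred b : n.-bseq 'I_n.+1 | is_partition n (parts b)]].

Definition num_partitions (n : nat) : nat := size (partitions n).

Lemma partitions_uniq n : uniq (partitions n).
Proof. by rewrite map_inj_uniq ?enum_uniq //; exact: bseq_parts_inj. Qed.

Lemma mem_partitions n p : (p \in partitions n) = is_partition n p.
Proof.
apply/mapP/idP => [[b]|part_p]; first by rewrite mem_enum => ? ->.
by have [b bp] := partition_bseq part_p; exists b; rewrite ?mem_enum ?inE bp.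
Qed.

Lemma mex_sumE M A s r n :
  mex_sum M A s r n = \sum_(p <- partitions n) mex M A s p ^ r.
Proof. by rewrite /mex_sum /partitions big_map big_enum. Qed.

Lemma geq_trans : transitive geq.
Proof. by move=> y x z /= xy yz; exact: leq_trans yz xy. Qed.

Lemma geq_anti : antisymmetric geq.
Proof. by move=> x y /=; rewrite andbC -eqn_leq => /eqP. Qed.

Lemma geq_total : total geq.
Proof. by move=> x y; exact: leq_total. Qed.

Lemma partition_sorted n p : p \in partitions n -> sorted geq p.
Proof. by rewrite mem_partitions => /and3P[]. Qed.

Lemma partition_gt0 n p k : p \in partitions n -> k \in p -> 0 < k.
Proof. by rewrite mem_partitions => /and3P[_ /allP + _]; apply. Qed.

Lemma partition_sumn n p : p \in partitions n -> sumn p = n.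
Proof. by rewrite mem_partitions => /and3P[_ _ /eqP]. Qed.

Lemma partition_perm_eq m n p q :
  p \in partitions m -> q \in partitions n -> perm_eq p q -> p = q.
Proof.
by move=> /partition_sorted ? /partition_sorted ?;
   exact: sorted_eq geq_trans geq_anti _ _ _ _.
Qed.

Lemma sort_partition n t :
  {in t, forall k, 0 < k} -> sumn t = n -> sort geq t \in partitions n.
Proof.
move=> t_gt0 sum_t; rewrite mem_partitions /is_partition.
rewrite (sort_sorted geq_total) -sum_t (perm_sumn (permEl (perm_sort geq t))).
by rewrite eqxx andbT /= all_sort; apply/allP.
Qed.

Lemma num_partitions_gt0 n : 0 < num_partitions n.
Proof.
have : sort geq (nseq n 1) \in partitions n.
  apply: sort_partition => [k|]; last by rewrite sumn_nseq mul1n.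
  by rewrite mem_nseq => /andP[_ /eqP ->].
by rewrite /num_partitions; case: (partitions n).
Qed.

(** * Partitions containing given parts *)

(** Multiset inclusion: both arguments stand for the multiset of their entries. *)
Definition contains (D p : seq nat) : bool :=
  all (fun k => count_mem k D <= count_mem k p) D.

Lemma containsP D p :
  reflect (exists t, perm_eq p (D ++ t)) (contains D p).
Proof.
apply: (iffP allP) => [le_Dp | [t pDt] k _ /=]; last first.
  by rewrite (permP pDt) count_cat leq_addr.
have /count_subseqP[u sub_up Du] x : count_mem x D <= count_mem x p.
  by have [/le_Dp //|/count_memPn ->] := boolP (x \in D).
have [t put] := perm_to_subseq sub_up; exists t.
by rewrite (permPl put) perm_cat2r perm_sym.
Qed.

(** Adding the parts D is a bijection from the partitions of n - |D| onto the
partitions of n that contain D. *)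
Lemma count_contains D n : {in D, forall k, 0 < k} ->
  count (contains D) (partitions n) =
  if sumn D <= n then num_partitions (n - sumn D) else 0.
Proof.
move=> D_gt0; case: leqP => [leDn | ltnD]; last first.
  apply/eqP; rewrite -leqn0 leqNgt -has_count; apply/hasP => -[p pn].
  case/containsP => t /perm_sumn; rewrite sumn_cat (partition_sumn pn) => nE.
  by rewrite nE ltnNge leq_addr in ltnD.
rewrite -size_filter /num_partitions.
rewrite -(size_map (fun p => sort geq (D ++ p)) (partitions _)).
apply/perm_size/uniq_perm; first by rewrite filter_uniq ?partitions_uniq.
  rewrite map_inj_in_uniq ?partitions_uniq // => p q pn qn eq_pq.
  apply: (partition_perm_eq pn qn); rewrite -(perm_cat2l D).
  by rewrite -(perm_sort geq (D ++ p)) eq_pq perm_sort.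
move=> p; rewrite mem_filter; apply/andP/mapP => [[/containsP[t pDt] pn] | [t tn ->]].
  have t_gt0 : {in t, forall k, 0 < k}.
    move=> k kt; apply: (partition_gt0 pn).
    by rewrite (perm_mem pDt) mem_cat kt orbT.
  exists (sort geq t).
    apply: sort_partition => //; have := perm_sumn pDt.
    by rewrite sumn_cat (partition_sumn pn) => ->; rewrite addKn.
  apply: (sorted_eq geq_trans geq_anti) (partition_sorted pn) (sort_sorted geq_total _) _.
  rewrite (permPl pDt) perm_sym perm_sort perm_cat2l; exact: permEl (perm_sort _ _).
split; first by apply/containsP; exists t; exact: permEl (perm_sort _ _).
apply: sort_partition => [k|]; last first.
  by rewrite sumn_cat (partition_sumn tn) subnKC.
by rewrite mem_cat => /orP[/D_gt0 //|]; exact: partition_gt0 tn.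
Qed.

(** By [count_contains], p(m) counts the partitions of n with at least n - m
ones. *)
Lemma num_partitions_mono : {homo num_partitions : m n / m <= n}.
Proof.
move=> m n le_mn; have := @count_contains (nseq (n - m) 1) n.
rewrite sumn_nseq mul1n leq_subr subKn // => <-; first exact: count_size.
by move=> k; rewrite mem_nseq => /andP[_ /eqP ->].
Qed.
(** * Partitions without ones are rare *)

Lemma num_partitionsS n :
  num_partitions n.+1 =
  num_partitions n + count (fun p => 1 \notin p) (partitions n.+1).
Proof.
rewrite {1}/num_partitions -(count_predC (fun p => 1 \in p)); congr (_ + _).
have := @count_contains [:: 1] n.+1; rewrite /= addn0 subn1 /= => <-.
  by apply: eq_count => p; rewrite /contains /= andbT -has_pred1 has_count.
by move=> k; rewrite inE => /eqP ->.
Qed.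

(** Replacing one part k of a partition without ones by k ones is injective in
the pair formed by the partition and k: the number of ones in the image is k. *)
Lemma sum_distinct_parts_le n :
  \sum_(p <- partitions n | 1 \notin p) size (undup p) <= num_partitions n.
Proof.
set P := [seq p <- partitions n | 1 \notin p].
pose f (p : seq nat) (k : nat) := sort geq (nseq k 1 ++ rem k p).
have -> : \sum_(p <- partitions n | 1 \notin p) size (undup p) =
          size [seq f p k | p <- P, k <- undup p].
  by rewrite size_allpairs_dep sumnE big_map big_filter.
apply: uniq_leq_size.
  apply: allpairs_uniq_dep; rewrite ?filter_uniq ?partitions_uniq //.
    by move=> p _; exact: undup_uniq.
  have ok (u : {_ : seq nat & nat}) :
      u \in [seq existT (fun=> nat) p k | p <- P, k <- undup p] ->
      [/\ 1 \notin tag u, tag u \in partitions n & tagged u \in tag u].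
    case/allpairsPdep => p [k [pP kp uE]]; move: pP kp; rewrite uE /=.
    by rewrite mem_filter mem_undup => /andP[].
  move=> [p k] [q l] /ok[/= p1 pn kp] /ok[/= q1 qn lq] eq_f.
  have pfE : perm_eq (nseq k 1 ++ rem k p) (nseq l 1 ++ rem l q).
    by rewrite -(perm_sort geq) [sort _ _]eq_f; exact: permEl (perm_sort _ _).
  have count1 j t : 1 \notin t -> count_mem 1 (nseq j 1 ++ rem j t) = j.
    move=> t1; rewrite count_cat count_nseq /= mul1n (count_memPn _) ?addn0 //.
    by apply: contra t1; exact: mem_rem.
  have eq_kl : k = l by rewrite -(count1 k p p1) (permP pfE) count1.
  subst l; suff -> : p = q by []; move: pfE; rewrite perm_cat2l -(perm_cons k) => pfE.
  apply: (partition_perm_eq pn qn).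
  by rewrite (permPl (perm_to_rem kp)) (permPl pfE) perm_sym perm_to_rem.
move=> u /allpairsPdep[p [k [+ + ->]]]; rewrite mem_filter mem_undup.
move=> /andP[_ pn] kp; apply: sort_partition => [j|].
  rewrite mem_cat mem_nseq => /orP[/andP[_ /eqP-> //]|/mem_rem].
  exact: partition_gt0 pn.
rewrite sumn_cat sumn_nseq mul1n -(partition_sumn pn).
by rewrite (perm_sumn (perm_to_rem kp)).
Qed.

(** A partition with at most L distinct sizes is determined by L pairs (size,
multiplicity), padded with pairs (0, 0), all entries being at most n. *)
Lemma count_few_sizes L n :
  count (fun p => size (undup p) <= L) (partitions n) <= n.+1 ^ (2 * L).
Proof.
pose decode (t : L.-tuple ('I_n.+1 * 'I_n.+1)) :=
  sort geq (flatten [seq nseq (nat_of_ord c.2) (nat_of_ord c.1) | c <- t]).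
have -> : n.+1 ^ (2 * L) = size (map decode (enum {: L.-tuple ('I_n.+1 * 'I_n.+1)})).
  by rewrite size_map -cardE card_tuple card_prod card_ord expnM -mulnn.
rewrite -size_filter; apply: uniq_leq_size.
  by rewrite filter_uniq ?partitions_uniq.
move=> p; rewrite mem_filter => /andP[le_pL pn].
have [b bp] : exists b : n.-bseq 'I_n.+1, parts b = p.
  by case/mapP: (pn) => b _ ->; exists b.
have le_n k : k \in p -> k <= n.
  by move=> /mem_leq_sumn; rewrite (partition_sumn pn).
have le_size : size p <= n by rewrite -bp size_map size_bseq.
pose g i := nth 0 (undup p) i.
pose t := [tuple of mkseq (fun i =>
  (inord (g i) : 'I_n.+1, inord (count_mem (g i) p) : 'I_n.+1)) L].
apply/mapP; exists t; first by rewrite mem_enum.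
apply: (sorted_eq geq_trans geq_anti) (partition_sorted pn) (sort_sorted geq_total _) _.
rewrite perm_sym perm_sort -map_comp.
rewrite (_ : map _ _ = [seq nseq (count_mem (g i) p) (g i) | i <- iota 0 L]); last first.
  apply: eq_map => i /=.
  have le_count : count_mem (g i) p <= n by exact: leq_trans (count_size _ _) le_size.
  rewrite !inordK ?ltnS // /g; have [lt_i|le_i] := ltnP i (size (undup p)).
    by apply: le_n; rewrite -mem_undup mem_nth.
  by rewrite nth_default.
rewrite -(subnKC le_pL) iotaD map_cat flatten_cat add0n.
have -> : flatten [seq nseq (count_mem (g i) p) (g i)
    | i <- iota (size (undup p)) (L - size (undup p))] = [::].
  apply/nilP; rewrite /nilp size_flatten sumnE big_map big_map big1_seq // => i /=.
  rewrite mem_iota => /andP[le_i _]; rewrite size_nseq /g nth_default //.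
  by apply/count_memPn/negP => /(partition_gt0 pn).
rewrite cats0 (map_comp (fun k => nseq (count_mem k p) k) g).
by rewrite -[map g _]/(mkseq _ _) mkseq_nth perm_count_undup.
Qed.

(** The multiplicities of the parts 2, ..., K + 1 can be chosen freely below B:
the weight used is then at most B (K + 1)^2, and ones fill the remainder. *)
Lemma num_partitions_ge K B n : B * K.+1 ^ 2 <= n -> B ^ K <= num_partitions n.
Proof.
move=> le_n.
pose w (m : {ffun 'I_K -> 'I_B}) :=
  flatten [seq nseq (m i) i.+2 | i <- enum 'I_K].
pose f m := sort geq (w m ++ nseq (n - sumn (w m)) 1).
have sum_w m : sumn (w m) <= n.
  apply: leq_trans le_n; rewrite sumn_flatten sumnE 2!big_map big_enum /=.
  apply: (@leq_trans (\sum_(i < K) K.+1 * B)).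
    by apply: leq_sum => i _; rewrite sumn_nseq leq_mul ?ltnS ?ltn_ord // ltnW.
  by rewrite sum_nat_const card_ord; nia.
have w_gt1 m k : k \in w m -> 1 < k.
  by case/flattenP => ? /mapP[i _ ->]; rewrite mem_nseq => /andP[_ /eqP ->].
have count_w m (i : 'I_K) : count_mem i.+2 (w m) = m i.
  rewrite count_flatten sumnE 2!big_map big_enum /= (bigD1 i) //= big1.
    by rewrite count_nseq /= eqxx mul1n addn0.
  by move=> j /negPf ne_ji; rewrite count_nseq /= !eqSS (inj_eq val_inj) ne_ji.
have -> : B ^ K = size (map f (enum {ffun 'I_K -> 'I_B})).
  by rewrite size_map -cardE card_ffun !card_ord.
apply: uniq_leq_size.
  rewrite map_inj_uniq ?enum_uniq // => m m' /(congr1 (count_mem _)) eq_f.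
  apply/ffunP => i; apply/val_inj => /=.
  have := eq_f i.+2; rewrite !(permP (permEl (perm_sort _ _))) !count_cat.
  by rewrite !count_nseq /= !addn0 !count_w.
move=> p /mapP[m _ ->]; apply: sort_partition => [k|].
  by rewrite mem_cat mem_nseq => /orP[/w_gt1/ltnW //|/andP[_ /eqP ->]].
by rewrite sumn_cat sumn_nseq mul1n subnKC.
Qed.

(** A partition with more than L distinct sizes contributes more than L to the
sum bounded by [sum_distinct_parts_le]; the others are outnumbered by all
partitions. *)
Lemma no_ones_small L : exists n0, forall n, n0 <= n ->
  L * count (fun p => 1 \notin p) (partitions n) <= 2 * num_partitions n.
Proof.
(* The polynomial bound has degree 2 L, so that K = 2 L + 1 free multiplicities
   suffice to beat it. *)
pose K := (2 * L).+1; pose E := 2 * K.+1 ^ 2.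
exists ((L * E ^ (2 * L)).+1 * K.+1 ^ 2) => n le_n.
pose B := n %/ K.+1 ^ 2.
have K2_gt0 : 0 < K.+1 ^ 2 by rewrite expn_gt0.
have le_B : L * E ^ (2 * L) < B by rewrite /B leq_divRL.
have le_nEB : n.+1 <= E * B.
  have B_gt0 : 0 < B by exact: leq_ltn_trans le_B.
  have := ltn_ceil n K2_gt0; rewrite -/B /E => /leq_trans; apply.
  by rewrite [leqRHS]mulnAC leq_mul2r; apply/orP; right; lia.
have few : L * n.+1 ^ (2 * L) <= num_partitions n.
  apply: leq_trans (num_partitions_ge (leq_divM n (K.+1 ^ 2))); rewrite -/B /K expnS.
  apply: leq_trans (leq_mul (ltnW le_B) (leqnn _)); rewrite -mulnA -expnMn.
  by rewrite leq_mul2l; case: posnP => //= L_gt0; rewrite leq_exp2r // muln_gt0.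
rewrite mulSn mul1n -sum1_count big_distrr /=.
apply: leq_trans (leq_add (sum_distinct_parts_le n) few).
apply: (@leq_trans (\sum_(p <- partitions n | 1 \notin p)
   (size (undup p) + L * (size (undup p) <= L)))).
  by apply: leq_sum => p _; case: leqP; nia.
rewrite big_split /= leq_add2l -big_distrr /= leq_mul2l; apply/orP; right.
apply: leq_trans (count_few_sizes L n).
by rewrite -sum1_count [leqRHS]big_mkcond [leqLHS]big_mkcond /=;
   apply: leq_sum => p _; do 2!case: ifP.
Qed.

(** The c increments of p between n - c and n are each at most p(n) / (2 c). *)
Lemma num_partitions_shift c : exists n0, forall n, n0 <= n ->
  num_partitions n <= 2 * num_partitions (n - c).
Proof.
have [n0 small] := no_ones_small (4 * c); exists (n0 + c) => n le_n.
have [->|c_gt0] := posnP c; first by rewrite subn0 leq_pmull.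
suff : forall d, d <= c -> 2 * c * num_partitions (n - (c - d)) <=
    2 * c * num_partitions (n - c) + d * num_partitions n.
  by move/(_ c (leqnn c)); rewrite subnn subn0; nia.
elim=> [|d IHd] lt_dc; first by rewrite subn0 mul0n addn0.
have nE : n - (c - d.+1) = (n - (c - d)).+1 by lia.
have le_S := num_partitions_mono (leq_subr (c - d.+1) n).
have no1 := small (n - (c - d.+1)) ltac:(lia); rewrite nE in le_S no1 *.
have pS := num_partitionsS (n - (c - d)); have {}IHd := IHd (ltnW lt_dc).
by clear -le_S no1 pS IHd; nia.
Qed.
(** * The tail of the mex *)

(** The parts A, A + M, ..., A + (j - 1) M, each repeated s times: the parts that
force the mex to be at least A + j M. *)
Definition run M A s j : seq nat :=
  flatten (mkseq (fun i => nseq s (A + i * M)) j).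

Lemma runS M A s j : run M A s j.+1 = run M A s j ++ nseq s (A + j * M).
Proof. by rewrite /run mkseqS flatten_rcons. Qed.

Lemma sumn_runS M A s j :
  sumn (run M A s j.+1) = sumn (run M A s j) + (A + j * M) * s.
Proof. by rewrite runS sumn_cat sumn_nseq. Qed.

Lemma run_gt0 M A s j : 0 < A -> {in run M A s j, forall k, 0 < k}.
Proof.
move=> A_gt0 k /flattenP[_ /mapP[i _ ->]].
by rewrite mem_nseq => /andP[_ /eqP ->]; rewrite addn_gt0 A_gt0.
Qed.

Lemma count_run M A s i j : 0 < M -> count_mem (A + i * M) (run M A s j) = (i < j) * s.
Proof.
move=> M_gt0; elim: j => //= j IHj; rewrite runS count_cat IHj count_nseq /=.
rewrite eqn_add2l eqn_pmul2r // ltnS (leq_eqVlt i) eq_sym -mulnDl.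
by case: ltngtP.
Qed.

Lemma contains_runP M A s j p : 0 < M ->
  reflect (forall i, i < j -> s <= count_mem (A + i * M) p)
          (contains (run M A s j) p).
Proof.
move=> M_gt0; apply: (iffP allP) => [le_p i lt_ij | le_p k].
  have [->//|s_gt0] := posnP s.
  have := count_run A s i j M_gt0; rewrite lt_ij mul1n => cE.
  by rewrite -[leqLHS]cE; apply: le_p; rewrite -has_pred1 has_count cE.
case/flattenP => _ /mapP[i + ->]; rewrite mem_iota => /= lt_ij.
by rewrite mem_nseq => /andP[_ /eqP ->]; rewrite count_run // lt_ij mul1n le_p.
Qed.

Lemma contains_run_mex M A s j p : 0 < A <= M -> 0 < s ->
  contains (run M A s j) p = (A + j * M <= mex M A s p).
Proof.
move=> hA s_gt0; have [/and3P[m_gt0 m_mod m_lt] m_min] := mexP p hA s_gt0.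
have /andP[A_gt0 le_AM] := hA; have M_gt0 := leq_trans A_gt0 le_AM.
apply/contains_runP/idP => // [le_p | le_m i lt_ij]; last first.
  rewrite leqNgt; apply/negP => lt_s.
  have /m_min : mex_cand M A s p (A + i * M).
    by rewrite /mex_cand addn_gt0 A_gt0 lt_s andbT addnC modnMDl /=.
  by rewrite leqNgt (leq_trans _ le_m) // ltn_add2l ltn_pmul2r.
have le_Am : A <= mex M A s p.
  rewrite leqNgt; apply/negP => lt_mA; move: m_mod.
  rewrite eq_sym eqn_mod_dvd ?(ltnW lt_mA) // => /dvdn_leq.
  rewrite subn_gt0 => /(_ lt_mA).
  by clear -m_gt0 lt_mA le_AM; lia.
move: m_mod; rewrite eqn_mod_dvd // => /dvdnP[i mE].
have {}mE : mex M A s p = A + i * M by rewrite -mE subnKC.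
rewrite mE leq_add2l leq_mul2r; apply/orP; right; rewrite leqNgt.
by apply/negP => /le_p; rewrite leqNgt -mE m_lt.
Qed.

Lemma sumn_run_shift M A A' s j :
  A <= M -> sumn (run M A s j) <= sumn (run M A' s j.+1).
Proof.
move=> le_AM; elim: j => // j IHj; rewrite sumn_runS (sumn_runS _ _ _ j.+1).
by rewrite leq_add // leq_mul2r mulSn; apply/orP; right; lia.
Qed.

(** The mex lies in a progression of step M, which moves a tail event by less
than M; comparing [run] for A with the longer [run] for A' costs M more, and
the difference between A and A' again at most M. *)
Lemma mex_tail_le M A A' s n x : 0 < A <= M -> 0 < A' <= M -> 0 < s ->
  count (fun p => x < mex M A' s p) (partitions n) <=
  count (fun p => x < mex M A s p + 3 * M) (partitions n).
Proof.
move=> hA hA' s_gt0; have /andP[A_gt0 le_AM] := hA; have /andP[A'_gt0 le_A'M] := hA'.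
have M_gt0 := leq_trans A_gt0 le_AM.
have [lt_x|le_x] := ltnP x (2 * M).
  apply: leq_trans (count_size _ _) _; rewrite eq_leq // -count_predT.
  by apply: eq_count => p /=; apply/esym; lia.
(* A' + j M is the last term of the progression that is at most x + 1. *)
pose j := (x.+1 - A') %/ M.
have j_gt0 : 0 < j by rewrite divn_gt0 //; lia.
have le_j : A' + j * M <= x.+1.
  by have := leq_divM (x.+1 - A') M; rewrite -/j; lia.
have ge_j : x.+1 < A' + j.+1 * M.
  by have := ltn_ceil (x.+1 - A') M_gt0; rewrite -/j; lia.
apply: (@leq_trans (count (contains (run M A' s j)) (partitions n))).
  by apply: sub_count => p /= lt_x; rewrite contains_run_mex // (leq_trans le_j).
apply: (@leq_trans (count (contains (run M A s j.-1)) (partitions n))).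
  rewrite !count_contains; try exact: run_gt0.
  have := sumn_run_shift A' s j.-1 le_AM; rewrite prednK // => le_sum.
  case: (leqP (sumn (run M A' s j)) n) => // le_n; rewrite (leq_trans le_sum le_n).
  by apply: num_partitions_mono; rewrite leq_sub2l.
apply: sub_count => p; rewrite contains_run_mex //=.
move: ge_j; rewrite -(prednK j_gt0) /= !mulSn; move: (j.-1 * M) => u; lia.
Qed.

(** * Comparison of the moments *)

(** First-order stochastic domination, by writing f(v) as f(0) plus the
increments of f below v. *)
Lemma leq_sum_tails (T : eqType) (t : seq T) (X Y : T -> nat) (f : nat -> nat) :
  {homo f : x y / x <= y} ->
  (forall x, count (fun p => x < X p) t <= count (fun p => x < Y p) t) ->
  \sum_(p <- t) f (X p) <= \sum_(p <- t) f (Y p).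
Proof.
move=> f_homo le_XY.
pose B := \max_(p <- t) maxn (X p) (Y p).
have layer (Z : T -> nat) : {in t, forall p, Z p <= B} ->
    \sum_(p <- t) f (Z p) = \sum_(p <- t) f 0 +
      \sum_(0 <= i < B) (f i.+1 - f i) * count (fun p => i < Z p) t.
  move=> le_ZB; transitivity (\sum_(p <- t) f 0 +
      \sum_(0 <= i < B) \sum_(p <- t | i < Z p) (f i.+1 - f i)); last first.
    by congr (_ + _); apply: eq_bigr => i _; rewrite big_const_seq iter_addn_0.
  rewrite (exchange_big_dep xpredT) //= -big_split /= [LHS]big_seq [RHS]big_seq.
  apply: eq_bigr => p /le_ZB le_p.
  by rewrite -(big_nat_widen 0 (Z p) B xpredT) // telescope_sumn // subnKC // f_homo.
have le_B p : p \in t -> maxn (X p) (Y p) <= B.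
  by move=> tp; exact: (leq_bigmax_seq (F := fun q => maxn (X q) (Y q))).
rewrite (layer X) => [|p /le_B]; last by rewrite geq_max => /andP[].
rewrite (layer Y) => [|p /le_B]; last by rewrite geq_max => /andP[].
by rewrite leq_add2l; apply: leq_sum => i _; rewrite leq_mul2l le_XY orbT.
Qed.

(** Bernoulli's inequality (1 - 1 / (K + 1))^r >= 1 - r / (K + 1) without
denominators. *)
Lemma expn_succ_le K r : K.+1 ^ r * (K.+1 - r) <= K ^ r * K.+1.
Proof.
elim: r => [|r IHr]; first by rewrite subn0.
apply: (@leq_trans (K.+1 ^ r * (K * (K.+1 - r)))).
  rewrite expnSr -mulnA leq_mul2l; apply/orP; right; rewrite subSS.
  have [le_rK|lt_Kr] := leqP r K; last by nia.
  by rewrite subSn //; nia.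
by rewrite mulnCA expnS -mulnA leq_mul2l IHr orbT.
Qed.

(** For x >= K D, x + D is at most (1 + 1 / K) x, and K is chosen so that
(1 + 1 / K)^r <= 1 + 1 / L; the constant C takes care of the smaller x. *)
Lemma expn_shift_le L D r : 0 < r -> exists C, forall x,
  L * (x + D) ^ r <= L.+1 * x ^ r + C.
Proof.
move=> r_gt0.
(* With K + 1 = r (L + 1), Bernoulli's bound 1 - r / (K + 1) is L / (L + 1). *)
pose K := (r * L.+1).-1.
have KE : K.+1 = r * L.+1 by rewrite prednK // muln_gt0 r_gt0.
have K_le : L * K.+1 ^ r <= L.+1 * K ^ r.
  have := expn_succ_le K r; have -> : K.+1 - r = r * L by rewrite KE mulnS addKn.
  rewrite {2}KE mulnCA [leqRHS]mulnCA leq_pmul2l // => le_K.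
  by rewrite [leqLHS]mulnC [leqRHS]mulnC.
exists (L * (K * D + D) ^ r) => x; have [lt_x|le_x] := ltnP x (K * D).
  apply: leq_trans (leq_addl _ _); rewrite leq_mul2l leq_exp2r //.
  by rewrite leq_add2r (ltnW lt_x) orbT.
apply: leq_trans (leq_addr _ _).
have [K0|K_gt0] := posnP K.
  by move: K_le; rewrite K0 exp1n exp0n // muln0 muln1 leqn0 => /eqP ->.
have Kr_gt0 : 0 < K ^ r by rewrite expn_gt0 K_gt0.
rewrite -(leq_pmul2l Kr_gt0) mulnCA -expnMn.
apply: (@leq_trans (L * (K.+1 * x) ^ r)).
  by rewrite leq_mul2l leq_exp2r // mulnDr mulSn addnC leq_add2r le_x orbT.
by rewrite expnMn mulnA [leqRHS]mulnA leq_mul2r [K ^ r * _]mulnC K_le orbT.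
Qed.

(** The mex is at least 2 T for at least half of the partitions of n, once n is
large: it suffices that they contain the first 2 T required runs of parts. *)
Lemma mex_sum_superlinear M A s r T : 0 < A <= M -> 0 < s -> 0 < r ->
  exists n0, forall n, n0 <= n -> T * num_partitions n <= mex_sum M A s r n.
Proof.
move=> hA s_gt0 r_gt0; have /andP[A_gt0 le_AM] := hA.
pose D := run M A s (2 * T).
have [n0 shift] := num_partitions_shift (sumn D).
exists (maxn n0 (sumn D)) => n; rewrite geq_max => /andP[/shift le_n le_Dn].
apply: (@leq_trans (2 * T * num_partitions (n - sumn D))).
  by rewrite [2 * T]mulnC -mulnA leq_mul2l le_n orbT.
have := @count_contains D n (@run_gt0 _ _ _ _ A_gt0); rewrite le_Dn => <-.
rewrite mex_sumE -sum1_count big_distrr big_mkcond /=; apply: leq_sum => p _.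
rewrite contains_run_mex //; case: (leqP _ (mex M A s p)) => // le_m; rewrite muln1.
have M_gt0 := leq_trans A_gt0 le_AM.
have le_Tm : 2 * T <= mex M A s p by apply: leq_trans le_m; nia.
case: r r_gt0 => // r _; apply: leq_trans le_Tm _; rewrite expnS.
by case: (mex M A s p) => // m; rewrite leq_pmulr // expn_gt0.
Qed.

Lemma mex_sum_compare M A A' s r L :
  0 < A <= M -> 0 < A' <= M -> 0 < s -> 0 < r ->
  exists n0, forall n, n0 <= n ->
    L * mex_sum M A' s r n <= L.+2 * mex_sum M A s r n.
Proof.
move=> hA hA' s_gt0 r_gt0.
have [C le_C] := expn_shift_le L (3 * M) r_gt0.
have [n0 large] := mex_sum_superlinear C hA s_gt0 r_gt0.
exists n0 => n /large; rewrite !mex_sumE => le_CS.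
have le_shift : \sum_(p <- partitions n) mex M A' s p ^ r <=
                \sum_(p <- partitions n) (mex M A s p + 3 * M) ^ r.
  apply: (@leq_sum_tails _ (partitions n) _ (fun p => mex M A s p + 3 * M)
    (fun x => x ^ r)).
    by move=> x y le_xy; rewrite leq_exp2r.
  by move=> x; exact: mex_tail_le.
apply: (@leq_trans (L * \sum_(p <- partitions n) (mex M A s p + 3 * M) ^ r)).
  by rewrite leq_mul2l le_shift orbT.
rewrite [leqRHS]mulSn [leqRHS]addnC; apply: leq_trans (leq_add (leqnn _) le_CS).
rewrite /num_partitions -sum1_size !big_distrr -big_split /=.
by apply: leq_sum => p _; rewrite muln1.
Qed.

(** * The limit *)

Lemma mex_sum_gt0 M A s r n : 0 < A <= M -> 0 < s -> 0 < mex_sum M A s r n.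
Proof.
move=> hA s_gt0; rewrite mex_sumE; apply: leq_trans (num_partitions_gt0 n) _.
rewrite /num_partitions -sum1_size; apply: leq_sum => p _.
by have [/and3P[m_gt0 _ _] _] := mexP p hA s_gt0; rewrite expn_gt0 m_gt0.
Qed.

Local Open Scope classical_set_scope.
Local Open Scope ring_scope.

Theorem corollary1p9 (R : realType) (A A' M r s : nat)
    (hA : (0 < A <= M)%N) (hA' : (0 < A' <= M)%N)
    (hr : (0 < r)%N) (hs : (0 < s)%N) :
  (mex_sum M A s r n)%:R / (mex_sum M A' s r n)%:R @[n --> \oo] --> (1 : R).
Proof.
apply/cvgrPdist_le => e e_gt0.
pose L := (Num.bound (2 / e)).+1.
have le_2Le : 2 <= L%:R * e :> R.
  rewrite -ler_pdivrMr //; apply: le_trans (ltW (archi_boundP _)) _.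
    by rewrite divr_ge0 // ltW.
  by rewrite ler_nat.
have [n1 le1] := mex_sum_compare L hA hA' hs hr.
have [n2 le2] := mex_sum_compare L hA' hA hs hr.
near=> n.
have {}le1 : (L * mex_sum M A' s r n <= L.+2 * mex_sum M A s r n)%N.
  by apply: le1; near: n; exact: nbhs_infty_ge.
have {}le2 : (L * mex_sum M A s r n <= L.+2 * mex_sum M A' s r n)%N.
  by apply: le2; near: n; exact: nbhs_infty_ge.
have := mex_sum_gt0 r n hA' hs.
move: (mex_sum M A s r n) (mex_sum M A' s r n) le1 le2 => S S'.
move=> le1 le2; rewrite -(ltr_nat R) => S'_gt0; move: le1 le2.
rewrite -!(ler_nat R) !natrM -[L.+2]addn2 natrD => le1 le2.
have L_gt0 : 0 < L%:R :> R by rewrite ltr0n.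
rewrite -[X in X - _](divff (lt0r_neq0 S'_gt0)) -mulrBl normrM normfV.
rewrite (gtr0_norm S'_gt0) ler_pdivrMr // ler_norml.
move: (S%:R) (S'%:R) (L%:R) le_2Le le1 le2 S'_gt0 L_gt0.
move=> x y l le_2Le le1 le2 y_gt0 l_gt0.
have le_2y : 2 * y <= l * (e * y) by rewrite mulrA ler_pM2r.
apply/andP; split; rewrite -(ler_pM2l l_gt0); nra.
Unshelve. all: by end_near.
Qed.
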